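(* Let $\mathcal F$ be a class of measurable functions $\mathbb X\times\mathbb A\to\mathbb R$, and let $\mathcal A$ be an online algorithm producing estimates $\hat\mu_i(\mathbf O_{i-1}):\mathbb X\times\mathbb A\to\mathbb R$, $i\in[n]$, each depending measurably only on $\mathbf O_{i-1}$. For $\mu:\mathbb X\times\mathbb A\to\mathbb R$ define the losses $$l_i(\mu):=\frac{g^2(X_i,A_i)}{(\pi_i^* )^2(X_i,\mathbf O_{i-1};A_i)}\{Y_i-\mu(X_i,A_i)\}^2,$$ and the regret $\mathrm{Regret}(n,\mathcal F;\mathcal A):=\sum_{i=1}^n l_i(\hat\mu_i(\mathbf O_{i-1}))-\inf_{\mu\in\mathcal F}\sum_{i=1}^n l_i(\mu)$. Then the AIPW estimator $\hat\tau_n^{\mathrm{AIPW}}$ built from these estimates satisfies $$\mathbb E_{\mathcal I^*}\big[\{\hat\tau_n^{\mathrm{AIPW}}(\mathbf O_n)-\tau(\mathcal I^* )\}^2\big]\le\frac1n\Big(v_*^2+\frac1n\mathbb E_{\mathcal I^*}[\mathrm{Regret}(n,\mathcal F;\mathcal A)]+\inf_{\mu\in\mathcal F}\|\mu-\mu^*\|_{(n)}^2\Big).$$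
   Context: Setup. Let $(\mathbb X,\lambda_{\mathbb X})$, $(\mathbb A,\lambda_{\mathbb A})$, $(\mathbb Y,\lambda_{\mathbb Y})$ be measurable spaces with $\sigma$-finite measures, $\mathbb Y\subseteq\mathbb R$, and $\mathbb O:=\mathbb X\times\mathbb A\times\mathbb Y$. A problem instance is a pair $\mathcal I=(\Xi,\Gamma)$ where $\Xi$ is a probability measure on $\mathbb X$ and $\Gamma$ is a Markov kernel from $\mathbb X\times\mathbb A$ to $\mathbb Y$. For each $i\in[n]$ a known behavioral policy $\Pi_i^*$ is a Markov kernel from $\mathbb X\times\mathbb O^{i-1}$ to $\mathbb A$ with density $\pi_i^*(x,\mathbf o_{i-1};\cdot):=d\Pi_i^*(\cdot\mid x,\mathbf o_{i-1})/d\lambda_{\mathbb A}$. Under instance $\mathcal I$, data $\mathbf O_n=(X_1,A_1,Y_1,\dots,X_n,A_n,Y_n)$ are generated sequentially: for $i=1,\dots,n$, $X_i\sim\Xi$ independently of $\mathbf O_{i-1}$; $A_i\mid(X_i,\mathbf O_{i-1})\sim\Pi_i^*(\cdot\mid X_i,\mathbf O_{i-1})$; $Y_i\mid(X_i,A_i,\mathbf O_{i-1})\sim\Gamma(\cdot\mid X_i,A_i)$. Here $\mathbf O_i$ denotes the first $i$ triples ($\mathbf O_0=\varnothing$). $\mathbb E_{\mathcal I}$, $\mathrm{Var}_{\mathcal I}$ denote expectation/variance under this law. The true instance is $\mathcal I^*=(\Xi^*,\Gamma^* )$, with treatment effect $\mu^*(x,a):=\int y\,\Gamma^*(dy\mid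 x,a)$ and conditional variance $\sigma^2(x,a):=\int(y-\mu^*(x,a))^2\Gamma^*(dy\mid x,a)<\infty$. A measurable evaluation function $g:\mathbb X\times\mathbb A\to\mathbb R$ is given; $\langle f,h\rangle_{\lambda_{\mathbb A}}:=\int_{\mathbb A}f(a)h(a)\,d\lambda_{\mathbb A}(a)$. The target is $\tau(\mathcal I^* ):=\mathbb E_{X\sim\Xi^*}[\langle g(X,\cdot),\mu^*(X,\cdot)\rangle_{\lambda_{\mathbb A}}]$. For $\varphi:\mathbb X\times\mathbb A\to\mathbb R$ and $k\in[n]$, $\|\varphi\|_{(k)}^2:=\frac1k\sum_{i=1}^k\mathbb E_{\mathcal I^*}\big[g^2(X_i,A_i)\varphi^2(X_i,A_i)/(\pi_i^* )^2(X_i,\mathbf O_{i-1};A_i)\big]$. The efficient variance is $v_*^2:=\mathrm{Var}_{X\sim\Xi^*}[\langle g(X,\cdot),\mu^*(X,\cdot)\rangle_{\lambda_{\mathbb A}}]+\|\sigma\|_{(n)}^2$. AIPW estimator: $\hat\tau_n^{\mathrm{AIPW}}(\mathbf O_n):=\frac1n\sum_{i=1}^n\big[\frac{g(X_i,A_i)}{\pi_i^*(X_i,\mathbf O_{i-1};A_i)}\{Y_i-\hat\mu_i(\mathbf O_{i-1})(X_i,A_i)\}+\langle g(X_i,\cdot),\hat\mu_i(\mathbf O_{i-1})(X_i,\cdot)\rangle_{\lambda_{\mathbb A}}\big]$. All expectations appearing are assumed finite (and the infimum inside the regret measurable).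
   Formalization: The formal theorem adds overlap (each behavioral density is positive wherever g is nonzero), without which the AIPW estimator can be biased and the bound false, and takes the class F nonempty. *)

(* Defs.v *)
From HB Require Import structures.
From mathcomp Require Import all_boot all_order all_algebra.
From mathcomp Require Import all_classical all_reals all_analysis.
From mathcomp Require Import measurable_realfun.
Import Order.TTheory GRing.Theory Num.Theory.
Set Implicit Arguments. Unset Strict Implicit. Unset Printing Implicit Defensive.
Local Open Scope ring_scope.
Local Open Scope classical_set_scope.

(* Conventions: rounds are indexed 0-based.  Round i (i < n)
   uses the history O_i : Hist i of the first i triples; thus the paper's
   pi^*_{i+1}, hat mu_{i+1} are our [pi i], [muhat i].  The outcome space Y
   is taken to be R itself (Y ⊆ R, a kernel into Y is a kernel into R). *)

Section Model.
Context (d1 d2 : measure_display) (X : measurableType d1) (A : measurableType d2)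
  (R : realType).

Fixpoint Hist (i : nat) : {d : measure_display & measurableType d} :=
  match i with
  | 0 => existT (fun d => measurableType d) _ (unit : measurableType _)
  | i.+1 => existT (fun d => measurableType d) _
             (((projT2 (Hist i)) * (X * A * R))%type : measurableType _)
  end.
Definition H (i : nat) := projT2 (Hist i).

Definition hpast i (h : H i.+1) : H i := h.1.
Definition hX i (h : H i.+1) : X := h.2.1.1.
Definition hA i (h : H i.+1) : A := h.2.1.2.
Definition hY i (h : H i.+1) : R := h.2.2.

Unset Implicit Arguments.
Variables (Xi : probability X R) (lamA : {measure set A -> \bar R})
  (Gam : R.-pker (X * A) ~> R) (pi : forall i, X -> H i -> A -> R).
Set Implicit Arguments.

Local Open Scope ereal_scope.

(* one step of the sequential data generation: given O_i = h, draw
   X ~ Xi, A ~ pi_i(X, h; .) dlamA, Y ~ Gam(. | X, A) *)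
Definition Cond i (F : H i.+1 -> \bar R) (h : H i) : \bar R :=
  \int[Xi]_x \int[lamA]_a
     ((pi i x h a)%:E * \int[Gam (x, a)]_y F ((h, (x, a, y)) : H i.+1)).

(* E_I[F(O_k)] for nonnegative F (iterated integrals = law of O_k) *)
Fixpoint Eplus (k : nat) : (H k -> \bar R) -> \bar R :=
  match k return (H k -> \bar R) -> \bar R with
  | 0 => fun F => F tt
  | k'.+1 => fun F => Eplus (Cond F)
  end.

Definition Exp (k : nat) (F : H k -> \bar R) : \bar R :=
  Eplus (F ^\+) - Eplus (F ^\-).

Local Close Scope ereal_scope.

Definition mu_star (x : X) (a : A) : R := fine (\int[Gam (x, a)]_y (y%:E))%E.
Definition sigma2 (x : X) (a : A) : R :=
  fine (\int[Gam (x, a)]_y (((y - mu_star x a) ^+ 2)%:E))%E.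
Definition sigma (x : X) (a : A) : R := Num.sqrt (sigma2 x a).
Definition innerA (f h : A -> R) : R := fine (\int[lamA]_a ((f a * h a)%:E))%E.

Variable g : X -> A -> R.

Definition tau : R := fine (\int[Xi]_x ((innerA (g x) (mu_star x))%:E))%E.
Definition VarX : \bar R :=
  (\int[Xi]_x (((innerA (g x) (mu_star x) - tau) ^+ 2)%:E))%E.

Definition normsq (k : nat) (phi : X -> A -> R) : \bar R :=
  ((k%:R^-1)%:E * \sum_(i < k)
     Eplus (fun h : H i.+1 =>
       ((g (hX h) (hA h) ^+ 2 * phi (hX h) (hA h) ^+ 2)
          / (pi i (hX h) (hpast h) (hA h)) ^+ 2)%:E))%E.

Definition vstar2 (n : nat) : \bar R := (VarX + normsq n sigma)%E.

Unset Implicit Arguments.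
Variable muhat : forall i, H i -> X -> A -> R.
Set Implicit Arguments.

Definition aipw_term i (h : H i.+1) : R :=
  g (hX h) (hA h) / pi i (hX h) (hpast h) (hA h)
    * (hY h - muhat i (hpast h) (hX h) (hA h))
  + innerA (g (hX h)) (muhat i (hpast h) (hX h)).

Fixpoint aipw_sum (k : nat) : H k -> R :=
  match k return H k -> R with
  | 0 => fun _ => 0
  | k'.+1 => fun h => aipw_sum (hpast h) + aipw_term h
  end.

Definition tau_hat (n : nat) (h : H n) : R := n%:R^-1 * aipw_sum h.

Definition loss i (mu : X -> A -> R) (h : H i.+1) : R :=
  g (hX h) (hA h) ^+ 2 / (pi i (hX h) (hpast h) (hA h)) ^+ 2
    * (hY h - mu (hX h) (hA h)) ^+ 2.

Fixpoint sumloss (m : forall i, H i -> X -> A -> R) (k : nat) : H k -> R :=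
  match k return H k -> R with
  | 0 => fun _ => 0
  | k'.+1 => fun h => sumloss m (hpast h) + loss (m k' (hpast h)) h
  end.

Definition Regret (n : nat) (F : set (X -> A -> R)) (h : H n) : \bar R :=
  ((sumloss muhat h)%:E
   - ereal_inf [set (sumloss (fun i _ => mu) h)%:E | mu in F])%E.

End Model.

(* Main.v *)
Require Import Defs.
From HB Require Import structures.
From mathcomp Require Import all_boot all_order all_algebra.
From mathcomp Require Import all_classical all_reals all_analysis.
From mathcomp Require Import measurable_realfun.
From mathcomp Require Import ring lra.
Import Order.TTheory GRing.Theory Num.Theory.
Set Implicit Arguments.
Unset Strict Implicit.
Unset Printing Implicit Defensive.
Local Open Scope ring_scope.
Local Open Scope classical_set_scope.
Local Open Scope ereal_scope.

(* n (tau_hat - tau) is a sum of conditionally centred terms.  Given the past,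
   the conditional second moment of the i-th term splits into Var_X and an action
   part; dropping a nonnegative square, the latter is at most the conditional
   expectation of the loss l_i(muhat_i).  Hence
     n^2 MSE <= n Var_X + E[sum_i l_i(muhat_i)].
   This one-step bound holds for every history, with value +oo allowed on the
   right, so no square integrability of the partial sums is needed.  By definition
   of the regret, E[sum_i l_i(muhat_i)] <= E[Regret] + E[sum_i l_i(mu)] for each mu
   in F, and expanding the square around mu^* gives
     E[sum_i l_i(mu)] = n (||sigma||^2 + ||mu - mu^*||^2). *)

(** * Integrals of quadratic polynomials under a probability measure *)

Section second_moment.
Context d (U : measurableType d) (R : realType) (P : {measure set U -> \bar R}).
Variable f : U -> R.
Hypothesis P1 : P setT = 1.
Hypothesis mf : measurable_fun setT f.
Hypothesis f2 : P.-integrable setT (fun u => (f u ^+ 2)%:E).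

Lemma integrable_prob_cst (c : R) : P.-integrable setT (fun=> c%:E).
Proof.
apply/integrableP; split; first exact: measurable_cst.
by rewrite integral_cst//= P1 mule1 ltry.
Qed.

(** Expanding [(|z| - 1)^2 >= 0] gives [|z| <= 1 + z^2], and constants are integrable for a
    probability measure. *)
Lemma integrable_of_sq : P.-integrable setT (fun u => (f u)%:E).
Proof.
have le_sq (z : R) : (`|z| <= 1 + z ^+ 2)%R.
  rewrite -(real_normK (num_real z)).
  by have := sqr_ge0 (`|z| - 1)%R; have := normr_ge0 z; nra.
apply: (le_integrable measurableT _ _ (integrableD measurableT (integrable_prob_cst 1) f2)).
  exact/measurable_EFinP.
by move=> u _; rewrite /= lee_fin (le_trans (le_sq _))// ler_norm.
Qed.

(** Applied to the outcome under [Gam] and to the covariate under [Xi]; each second-moment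
    computation then becomes a polynomial identity in the moments. *)
Lemma integral_quadratic (c0 c1 c2 : R) :
  \int[P]_u (c0 + c1 * f u + c2 * f u ^+ 2)%:E =
  (c0 + c1 * fine (\int[P]_u (f u)%:E) + c2 * fine (\int[P]_u (f u ^+ 2)%:E))%:E.
Proof.
have i1 := integrable_of_sq.
under eq_integral do rewrite !EFinD !EFinM.
rewrite integralD//=; last 2 first.
- by apply: integrableD => //; [exact: integrable_prob_cst|exact: integrableZl].
- exact: integrableZl.
rewrite integralD//=; [|exact: integrable_prob_cst|exact: integrableZl].
rewrite !integralZl// integral_cst//= P1 mule1.
by rewrite !EFinD !EFinM !fineK//; exact: integrable_fin_num.
Qed.

End second_moment.

(** * Measurability of integrals depending on a parameter *)

Section pullback_kernel.
Context d d' d'' (T : measurableType d) (U : measurableType d')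
  (V : measurableType d'') (R : realType).
Variables (k : R.-pker U ~> V) (f : T -> U).

(** [Gam] reads only the pair (x, a), while integrands also depend on the past. Pulling the kernel
    back along a map from the larger state gives a kernel on that state. The proof [mf] is an
    argument so that the kernel structure can be attached to [kpull mf]. *)
Definition kpull (mf : measurable_fun [set: T] f) (t : T) :
  {measure set V -> \bar R} := k (f t).

Hypothesis mf : measurable_fun [set: T] f.

Let measurable_kpull B : measurable B ->
  measurable_fun [set: T] (kpull mf ^~ B).
Proof. by move=> mB; exact: measurableT_comp (measurable_kernel k B mB) mf. Qed.

HB.instance Definition _ := isKernel.Build _ _ _ _ _ (kpull mf) measurable_kpull.

Let kpull_setT t : kpull mf t [set: V] = 1.
Proof. exact: prob_kernel. Qed.

HB.instance Definition _ :=
  Kernel_isProbability.Build _ _ _ _ _ (kpull mf) kpull_setT.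

Lemma measurable_integral_kpull (F : T * V -> \bar R) :
    (forall z, 0 <= F z) -> measurable_fun setT F ->
  measurable_fun setT (fun t => \int[k (f t)]_v F (t, v)).
Proof.
by move=> F0 mF; exact: (measurable_fun_integral_sfinite_kernel F (kpull mf)).
Qed.

End pullback_kernel.

(** Tonelli gives measurability for nonnegative integrands, so positive and negative parts are
    treated separately. This serves the signed integrals in [innerA]; the next lemma is the kernel
    analogue, for [mu_star] and [sigma2]. *)
Lemma measurable_fine_integral d d' (Z : measurableType d)
    (A : measurableType d') (R : realType)
    (m : {sigma_finite_measure set A -> \bar R}) (f : Z -> A -> R) :
    measurable_fun setT (fun p : Z * A => f p.1 p.2) ->
  measurable_fun setT (fun z => fine (\int[m]_a (f z a)%:E)).
Proof.
move=> mf; apply: measurableT_comp; first exact: fine_measurable.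
have mE : measurable_fun setT (fun p : Z * A => (f p.1 p.2)%:E).
  exact/measurable_EFinP.
under eq_fun => z.
  rewrite integralE (funepos_comp (fun p : Z * A => (f p.1 p.2)%:E) (pair z)).
  rewrite (funeneg_comp (fun p : Z * A => (f p.1 p.2)%:E) (pair z)).
  over.
apply: emeasurable_funB.
- exact: (measurable_fun_fubini_tonelli_F _ (measurable_funepos mE)
    (funepos_ge0 _)).
- exact: (measurable_fun_fubini_tonelli_F _ (measurable_funeneg mE)
    (funeneg_ge0 _)).
Qed.

Lemma measurable_fine_kernel d d' (Z : measurableType d)
    (Y : measurableType d') (R : realType)
    (k : R.-pker Z ~> Y) (f : Z -> Y -> R) :
    measurable_fun setT (fun p : Z * Y => f p.1 p.2) ->
  measurable_fun setT (fun z => fine (\int[k z]_y (f z y)%:E)).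
Proof.
move=> mf; apply: measurableT_comp; first exact: fine_measurable.
have mE : measurable_fun setT (fun p : Z * Y => (f p.1 p.2)%:E).
  exact/measurable_EFinP.
under eq_fun => z.
  rewrite integralE (funepos_comp (fun p : Z * Y => (f p.1 p.2)%:E) (pair z)).
  rewrite (funeneg_comp (fun p : Z * Y => (f p.1 p.2)%:E) (pair z)).
  over.
apply: emeasurable_funB.
- exact: (measurable_fun_integral_sfinite_kernel _ k (funepos_ge0 _)
    (measurable_funepos mE)).
- exact: (measurable_fun_integral_sfinite_kernel _ k (funeneg_ge0 _)
    (measurable_funeneg mE)).
Qed.

(** On nonnegative reals the inverse is the power -1, including at 0 where both are 0. *)
Lemma measurable_funV_ge0 d (T : measurableType d) (R : realType) (f : T -> R) :
    (forall t, 0 <= f t)%R -> measurable_fun setT f ->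
  measurable_fun setT (fun t => (f t)^-1)%R.
Proof.
move=> f0 mf; under eq_fun do rewrite -powR_inv1//.
exact: measurableT_comp (measurable_powR (-1)%R) mf.
Qed.

(** * One round of data generation: measurability, monotonicity and linearity *)

Section step.
Context dT d1 d2 (T : measurableType dT) (X : measurableType d1)
  (A : measurableType d2) (R : realType).
Variables (Xi : probability X R) (lamA : {sigma_finite_measure set A -> \bar R})
  (Gam : R.-pker (X * A) ~> R) (p : X -> T -> A -> R).
Hypothesis mp : measurable_fun setT (fun q : X * T * A => p q.1.1 q.1.2 q.2).
Hypothesis p0 : forall x t a, (0 <= p x t a)%R.
Hypothesis p1 : forall x t, \int[lamA]_a (p x t a)%:E = 1.

Implicit Types F : T * (X * A * R) -> \bar R.

(* [step] is [Cond] with the history space [H X A R i] replaced by an arbitrary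
   measurable type [T]. *)
Definition draw (F : T * (X * A * R) -> \bar R) (t : T) (x : X) (a : A) :=
  (p x t a)%:E * \int[Gam (x, a)]_y F (t, (x, a, y)).

Definition step (F : T * (X * A * R) -> \bar R) (t : T) : \bar R :=
  \int[Xi]_x \int[lamA]_a draw F t x a.

Lemma draw_ge0 F t x a : (forall o, 0 <= F o) -> 0 <= draw F t x a.
Proof. by move=> F0; rewrite mule_ge0 ?lee_fin// integral_ge0. Qed.

Lemma step_ge0 F t : (forall o, 0 <= F o) -> 0 <= step F t.
Proof.
by move=> F0; apply: integral_ge0 => x _; apply: integral_ge0 => a _; exact: draw_ge0.
Qed.

Lemma measurable_draw F : (forall o, 0 <= F o) -> measurable_fun setT F ->
  measurable_fun setT (fun q : T * X * A => draw F q.1.1 q.1.2 q.2).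
Proof.
move=> F0 mF; apply: emeasurable_funM.
  apply/measurable_EFinP.
  apply: (measurableT_comp mp (g := fun q : T * X * A => ((q.1.2, q.1.1), q.2))).
  by apply: measurable_fun_pair => //; apply: measurable_fun_pair => //; exact: measurableT_comp.
have mc : measurable_fun setT (fun q : T * X * A => (q.1.2, q.2)).
  by apply: measurable_fun_pair => //; exact: measurableT_comp.
(* The state (t, x, a) is sent by [mc] to the argument (x, a) of [Gam]; the integrand is [F] after
   reassociating the tuple. *)
apply: (@measurable_integral_kpull _ _ _ _ _ _ _ Gam _ mc
  (fun z : T * X * A * R => F (z.1.1.1, (z.1.1.2, z.1.2, z.2)))) => //.
apply: measurableT_comp => //.
apply: measurable_fun_pair; first by do 2 apply: measurableT_comp => //.
apply: measurable_fun_pair => //; apply: measurable_fun_pair; last exact: measurableT_comp.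
by do 2 apply: measurableT_comp => //.
Qed.

Lemma measurable_int_draw F : (forall o, 0 <= F o) -> measurable_fun setT F ->
  measurable_fun setT (fun q : T * X => \int[lamA]_a draw F q.1 q.2 a).
Proof.
move=> F0 mF.
apply: (measurable_fun_fubini_tonelli_F (fun q : T * X * A => draw F q.1.1 q.1.2 q.2)).
  exact: measurable_draw.
by move=> q; exact: draw_ge0.
Qed.

Lemma measurable_step F : (forall o, 0 <= F o) -> measurable_fun setT F ->
  measurable_fun setT (step F).
Proof.
move=> F0 mF.
apply: (measurable_fun_fubini_tonelli_F (fun q : T * X => \int[lamA]_a draw F q.1 q.2 a)).
  exact: measurable_int_draw.
by move=> q; apply: integral_ge0 => a _; exact: draw_ge0.
Qed.

Section step_linear.
Variable t : T.

Lemma measurable_outcome F x a : measurable_fun setT F ->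
  measurable_fun setT (fun y : R => F (t, (x, a, y))).
Proof. by move=> mF; apply: measurableT_comp => //; exact: measurable_fun_pair. Qed.

Lemma measurable_draw_action F x : (forall o, 0 <= F o) -> measurable_fun setT F ->
  measurable_fun setT (draw F t x).
Proof.
move=> F0 mF; apply: (measurableT_comp (measurable_draw F0 mF) (g := pair (t, x))).
exact: measurable_fun_pair.
Qed.

Lemma measurable_draw_covariate F : (forall o, 0 <= F o) -> measurable_fun setT F ->
  measurable_fun setT (fun x => \int[lamA]_a draw F t x a).
Proof.
move=> F0 mF; apply: (measurableT_comp (measurable_int_draw F0 mF) (g := pair t)).
exact: measurable_fun_pair.
Qed.

Lemma le_step F1 F2 : (forall o, 0 <= F1 o) ->
    measurable_fun setT F1 -> measurable_fun setT F2 ->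
  (forall o, F1 o <= F2 o) -> step F1 t <= step F2 t.
Proof.
move=> F10 mF1 mF2 F12.
have F20 o : 0 <= F2 o by exact: le_trans (F12 o).
apply: ge0_le_integral => //.
- by move=> x _; apply: integral_ge0 => a _; exact: draw_ge0.
- exact: measurable_draw_covariate.
- exact: measurable_draw_covariate.
move=> x _; apply: ge0_le_integral => //.
- by move=> a _; exact: draw_ge0.
- exact: measurable_draw_action.
- exact: measurable_draw_action.
move=> a _; rewrite lee_wpmul2l ?lee_fin//.
by apply: ge0_le_integral => //; exact: measurable_outcome.
Qed.

Lemma drawD F1 F2 x a : (forall o, 0 <= F1 o) -> (forall o, 0 <= F2 o) ->
    measurable_fun setT F1 -> measurable_fun setT F2 ->
  draw (fun o => F1 o + F2 o) t x a = draw F1 t x a + draw F2 t x a.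
Proof.
move=> F10 F20 mF1 mF2; rewrite /draw ge0_integralD//; last 2 first.
- exact: measurable_outcome.
- exact: measurable_outcome.
by rewrite ge0_muleDr ?integral_ge0.
Qed.

Lemma stepD F1 F2 : (forall o, 0 <= F1 o) -> (forall o, 0 <= F2 o) ->
    measurable_fun setT F1 -> measurable_fun setT F2 ->
  step (fun o => F1 o + F2 o) t = step F1 t + step F2 t.
Proof.
move=> F10 F20 mF1 mF2; rewrite /step -ge0_integralD//; last 4 first.
- by move=> x _; apply: integral_ge0 => a _; exact: draw_ge0.
- exact: measurable_draw_covariate.
- by move=> x _; apply: integral_ge0 => a _; exact: draw_ge0.
- exact: measurable_draw_covariate.
apply: eq_integral => x _; rewrite -ge0_integralD//; last 4 first.
- by move=> a _; exact: draw_ge0.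
- exact: measurable_draw_action.
- by move=> a _; exact: draw_ge0.
- exact: measurable_draw_action.
by apply: eq_integral => a _; rewrite drawD.
Qed.

Lemma stepZ (c : R) F : (0 <= c)%R -> (forall o, 0 <= F o) ->
    measurable_fun setT F ->
  step (fun o => c%:E * F o) t = c%:E * step F t.
Proof.
move=> c0 F0 mF; rewrite /step -ge0_integralZl ?lee_fin//; last 2 first.
- exact: measurable_draw_covariate.
- by move=> x _; apply: integral_ge0 => a _; exact: draw_ge0.
apply: eq_integral => x _; rewrite -ge0_integralZl ?lee_fin//; last 2 first.
- exact: measurable_draw_action.
- by move=> a _; exact: draw_ge0.
apply: eq_integral => a _; rewrite /draw ge0_integralZl ?lee_fin//; first by rewrite muleCA.
exact: measurable_outcome.
Qed.

Lemma integral_density_cst (c : \bar R) x : 0 <= c -> \int[lamA]_a ((p x t a)%:E * c) = c.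
Proof.
move=> c0; rewrite ge0_integralZr// ?p1 ?mul1e//.
  apply/measurable_EFinP.
  apply: (measurableT_comp mp (g := pair (x, t))); exact: measurable_fun_pair.
by move=> a _; rewrite lee_fin.
Qed.

Lemma integral_prob_cst d (U : measurableType d) (P : measure U R) (c : \bar R) :
  P setT = 1 -> \int[P]_u c = c.
Proof. by move=> P1; rewrite integral_cst// P1 mule1. Qed.

(** The outcome kernel, the action density and the covariate law each have total mass 1. *)
Lemma step_past (G : T -> \bar R) : (forall t, 0 <= G t) ->
  step (fun o => G o.1) t = G t.
Proof.
move=> G0; rewrite -[RHS](@integral_prob_cst _ _ Xi _ (probability_setT Xi)).
apply: eq_integral => x _; rewrite -[RHS](@integral_density_cst _ x)//.
by apply: eq_integral => a _; rewrite /draw/= integral_prob_cst//; exact: prob_kernel.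
Qed.

End step_linear.

(** * Conditional second moments given covariate and action *)

Section aipw_step.
Hypothesis Gam2 : forall x a, (Gam (x, a)).-integrable setT (fun y => (y ^+ 2)%:E).
Variable g : X -> A -> R.
Hypothesis mg : measurable_fun setT (fun q : X * A => g q.1 q.2).
Hypothesis p_gt0 : forall x t a, g x a != 0%R -> (0 < p x t a)%R.

Definition wsq (phi : X -> A -> R) (o : T * (X * A * R)) : R :=
  (g o.2.1.1 o.2.1.2 ^+ 2 * phi o.2.1.1 o.2.1.2 ^+ 2
     / p o.2.1.1 o.1 o.2.1.2 ^+ 2)%R.

Definition wloss (m : T -> X -> A -> R) (o : T * (X * A * R)) : R :=
  (g o.2.1.1 o.2.1.2 ^+ 2 / p o.2.1.1 o.1 o.2.1.2 ^+ 2
    * (o.2.2 - m o.1 o.2.1.1 o.2.1.2) ^+ 2)%R.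

Definition aipw (m : T -> X -> A -> R) (o : T * (X * A * R)) : R :=
  (g o.2.1.1 o.2.1.2 / p o.2.1.1 o.1 o.2.1.2
    * (o.2.2 - m o.1 o.2.1.1 o.2.1.2)
  + innerA lamA (g o.2.1.1) (m o.1 o.2.1.1))%R.

Let mom2 x a : R := fine (\int[Gam (x, a)]_y (y ^+ 2)%:E).

Lemma outcome_quadratic x a (c0 c1 c2 : R) :
  \int[Gam (x, a)]_y (c0 + c1 * y + c2 * y ^+ 2)%:E =
  (c0 + c1 * mu_star Gam x a + c2 * mom2 x a)%:E.
Proof. by apply: integral_quadratic => //; exact: prob_kernel. Qed.

(** Covers both squares of interest, with [c] the weight [g / p]: the loss is the case [b = 0], and
    for the AIPW error [b] gathers all terms free of the outcome. *)
Lemma outcome_sq x a (b c z : R) :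
  \int[Gam (x, a)]_y ((b + c * (y - z)) ^+ 2)%:E =
  (b ^+ 2 + 2 * b * c * (mu_star Gam x a - z)
     + c ^+ 2 * (mom2 x a - 2 * z * mu_star Gam x a + z ^+ 2))%:E.
Proof.
under eq_integral => y _.
  rewrite (_ : (_ ^+ 2)%R = ((b - c * z) ^+ 2 + (2 * c * (b - c * z)) * y
    + c ^+ 2 * y ^+ 2)%R); last by ring.
  over.
by rewrite outcome_quadratic; congr (_%:E); ring.
Qed.

Lemma sigma2E x a : sigma2 Gam x a = (mom2 x a - mu_star Gam x a ^+ 2)%R.
Proof.
rewrite /sigma2; under eq_integral => y _.
  rewrite (_ : (_ ^+ 2)%R = (mu_star Gam x a ^+ 2 + (- (2 * mu_star Gam x a)) * y
    + 1 * y ^+ 2)%R); last by ring.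
  over.
by rewrite outcome_quadratic /=; ring.
Qed.

Lemma sigma_sq x a : (sigma Gam x a ^+ 2 = mom2 x a - mu_star Gam x a ^+ 2)%R.
Proof.
rewrite -sigma2E sqr_sqrtr// fine_ge0//.
by apply: integral_ge0 => y _; rewrite lee_fin sqr_ge0.
Qed.

(** Where [g] is nonzero, overlap allows the density to be cancelled; elsewhere both sides are 0.
    This is what makes inverse propensity weighting unbiased. *)
Lemma density_ratio x t a : (p x t a * (g x a / p x t a) = g x a)%R.
Proof.
have [->|g0] := eqVneq (g x a) 0%R; first by rewrite mul0r mulr0.
by rewrite mulrCA divff ?mulr1// gt_eqF// p_gt0.
Qed.

Lemma draw_wloss m t x a :
  draw (fun o => (wloss m o)%:E) t x a =
  (p x t a * ((g x a / p x t a) ^+ 2 * (mom2 x a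
     - 2 * m t x a * mu_star Gam x a + m t x a ^+ 2)))%:E.
Proof.
rewrite /draw /wloss /=; under eq_integral => y _.
  rewrite -expr_div_n -exprMn -[X in (X ^+ 2)%R]add0r.
  over.
by rewrite outcome_sq -EFinM; congr (_%:E); ring.
Qed.

(** Bias-variance decomposition: [mu_star] is the mean of [Gam], so the cross term in the squared
    deviation from [mu] integrates to 0. *)
Lemma draw_wloss_split (mu : X -> A -> R) t x a :
  draw (fun o => (wloss (fun=> mu) o)%:E) t x a =
  draw (fun o => (wsq (sigma Gam) o)%:E
           + (wsq (fun x a => mu x a - mu_star Gam x a)%R o)%:E) t x a.
Proof.
rewrite draw_wloss /draw /wsq /=.
under eq_integral do rewrite -EFinD.
rewrite integral_prob_cst//; last exact: prob_kernel.
by rewrite -EFinM sigma_sq expr_div_n; congr (_%:E); ring.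
Qed.

(** * Measurability of the one-round quantities *)

Lemma measurable_mu_star :
  measurable_fun setT (fun q : X * A => mu_star Gam q.1 q.2).
Proof.
rewrite (_ : (fun _ => _) = fun q : X * A => fine (\int[Gam q]_y y%:E)).
  by apply: (measurable_fine_kernel Gam (f := fun _ y => y)); exact: measurable_snd.
by apply/funext => -[].
Qed.

Lemma measurable_sigma :
  measurable_fun setT (fun q : X * A => sigma Gam q.1 q.2).
Proof.
apply: (measurableT_comp (f := @Num.sqrt R)).
  by apply: continuous_measurable_fun; exact: sqrt_continuous.
rewrite (_ : (fun _ => _) = fun q : X * A =>
    fine (\int[Gam q]_y ((y - mu_star Gam q.1 q.2) ^+ 2)%:E)).
  apply: (measurable_fine_kernel Gam
    (f := fun q y => ((y - mu_star Gam q.1 q.2) ^+ 2)%R)).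
  apply: measurable_funX; apply: measurable_funB; first exact: measurable_snd.
  by apply: (measurableT_comp measurable_mu_star); exact: measurable_fst.
by apply/funext => -[].
Qed.

Let m_xa : measurable_fun setT
  (fun o : T * (X * A * R) => (o.2.1.1, o.2.1.2)).
Proof.
rewrite (_ : (fun _ => _) = fun o : T * (X * A * R) => o.2.1).
  by apply: measurableT_comp => //; exact: measurable_fst.
by apply/funext => -[? [[]]].
Qed.

Let m_tx : measurable_fun setT (fun o : T * (X * A * R) => (o.1, o.2.1.1)).
Proof.
apply: measurable_fun_pair => //.
by apply: measurableT_comp => //; apply: measurableT_comp.
Qed.

Let m_txa : measurable_fun setT
  (fun o : T * (X * A * R) => (o.1, o.2.1.1, o.2.1.2)).
Proof.
apply: measurable_fun_pair => //.
by apply: measurableT_comp => //; apply: measurableT_comp.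
Qed.

Let m_y : measurable_fun setT (fun o : T * (X * A * R) => o.2.2).
Proof. exact: measurableT_comp. Qed.

Let m_p : measurable_fun setT
  (fun o : T * (X * A * R) => (p o.2.1.1 o.1 o.2.1.2)^-1)%R.
Proof.
apply: measurable_funV_ge0 => //.
apply: (measurableT_comp mp (g := fun o : T * (X * A * R) => (o.2.1.1, o.1, o.2.1.2))).
apply: measurable_fun_pair => /=.
  by apply: measurable_fun_pair => //; apply: measurableT_comp => //; apply: measurableT_comp.
by apply: measurableT_comp => //; apply: measurableT_comp.
Qed.

Lemma measurable_wsq (phi : X -> A -> R) :
  measurable_fun setT (fun q : X * A => phi q.1 q.2) ->
  measurable_fun setT (wsq phi).
Proof.
move=> mphi; rewrite /wsq; under eq_fun do rewrite -exprVn.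
apply: measurable_funM; last exact: measurable_funX.
apply: measurable_funM; apply: measurable_funX.
  exact: measurableT_comp mg m_xa.
exact: measurableT_comp mphi m_xa.
Qed.

(** * The one-round bound for an estimate fixed by the past *)

Section online_estimate.
Variable m : T -> X -> A -> R.
Hypothesis mm : measurable_fun setT (fun q : T * X * A => m q.1.1 q.1.2 q.2).

Lemma measurable_wloss : measurable_fun setT (wloss m).
Proof.
rewrite /wloss; under eq_fun do rewrite -exprVn.
apply: measurable_funM; last first.
  apply: measurable_funX; apply: measurable_funB => //.
  exact: measurableT_comp mm m_txa.
apply: measurable_funM; apply: measurable_funX => //.
exact: measurableT_comp mg m_xa.
Qed.

Lemma measurable_aipw : measurable_fun setT (aipw m).
Proof.
rewrite /aipw; apply: measurable_funD.
  apply: measurable_funM.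
    by apply: measurable_funM => //; exact: measurableT_comp mg m_xa.
  by apply: measurable_funB => //; exact: measurableT_comp mm m_txa.
suff mi : measurable_fun setT (fun q : T * X => innerA lamA (g q.2) (m q.1 q.2)).
  exact: measurableT_comp mi m_tx.
apply: (measurable_fine_integral lamA (f := fun (q : T * X) a => (g q.2 a * m q.1 q.2 a)%R)).
apply: measurable_funM => //.
apply: (measurableT_comp mg (g := fun q : T * X * A => (q.1.2, q.2))).
by apply: measurable_fun_pair => //; exact: measurableT_comp.
Qed.

Let tau0 := tau Xi lamA Gam g.
Let theta x := innerA lamA (g x) (mu_star Gam x).

Hypothesis int_star : forall x,
  lamA.-integrable setT (fun a => (g x a * mu_star Gam x a)%:E).
Hypothesis int_hat : forall t x,
  lamA.-integrable setT (fun a => (g x a * m t x a)%:E).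
Hypothesis int_tau : Xi.-integrable setT (fun x => (theta x ^+ 2)%:E).

Let measurable_theta : measurable_fun setT theta.
Proof.
apply: (measurable_fine_integral lamA (f := fun x a => (g x a * mu_star Gam x a)%R)).
by apply: measurable_funM => //; exact: measurable_mu_star.
Qed.

(** The usual variance formula, stated as a real number so that it also yields finiteness of
    [VarX]. *)
Lemma VarXE : VarX Xi lamA Gam g =
  (fine (\int[Xi]_x (theta x ^+ 2)%:E) - tau0 ^+ 2)%:E.
Proof.
rewrite /VarX -/tau0; under eq_integral => x _.
  rewrite (_ : (_ ^+ 2)%R = (tau0 ^+ 2 + (- (2 * tau0)) * theta x
    + 1 * theta x ^+ 2)%R); last by rewrite /theta; ring.
  over.
rewrite (integral_quadratic (probability_setT Xi) measurable_theta int_tau).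
by rewrite -[fine (\int[Xi]_u (theta u)%:E)]/tau0; congr (_%:E); ring.
Qed.

(** [theta - tau0] has mean 0 under [Xi], so the cross term with [c] vanishes. *)
Lemma covariate_sq (c : R) :
  \int[Xi]_x ((c + theta x - tau0) ^+ 2)%:E = (c ^+ 2)%:E + VarX Xi lamA Gam g.
Proof.
under eq_integral => x _.
  rewrite (_ : (_ ^+ 2)%R = ((c - tau0) ^+ 2 + (2 * (c - tau0)) * theta x
    + 1 * theta x ^+ 2)%R); last by ring.
  over.
rewrite (integral_quadratic (probability_setT Xi) measurable_theta int_tau).
rewrite VarXE -EFinD -[fine (\int[Xi]_u (theta u)%:E)]/tau0.
by congr (_%:E); ring.
Qed.

(* The two sides differ by [(theta x - thetahat) ^+ 2], up to the weighted loss
   integral, which may be [+oo]. *)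
Lemma action_sq (s : T -> R) t x :
  \int[lamA]_a draw (fun o => ((s o.1 + aipw m o - tau0) ^+ 2)%:E) t x a <=
  ((s t + theta x - tau0) ^+ 2)%:E + \int[lamA]_a draw (fun o => (wloss m o)%:E) t x a.
Proof.
set L := \int[lamA]_a draw (fun o => (wloss m o)%:E) t x a.
have loss0 o : 0 <= (wloss m o)%:E.
  by rewrite lee_fin mulr_ge0 ?sqr_ge0// divr_ge0 ?sqr_ge0.
have mloss : measurable_fun setT (fun o => (wloss m o)%:E).
  by apply/measurable_EFinP; exact: measurable_wloss.
(* An infinite loss makes the bound trivial; a finite one makes the loss integrable, so the signed
   integral below may be split. *)
have [->|Lfin] := eqVneq L +oo; first by rewrite addey// leey.
have iL : lamA.-integrable setT (draw (fun o => (wloss m o)%:E) t x).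
  apply/integrableP; split; first exact: measurable_draw_action.
  under eq_integral do rewrite gee0_abs ?draw_ge0//.
  by rewrite ltey.
set thetahat := innerA lamA (g x) (m t x).
(* [b] is the part of the error that depends on neither the action nor the outcome. *)
set b := (s t + thetahat - tau0)%R.
have ip : lamA.-integrable setT (fun a => (p x t a)%:E).
  apply/integrableP; split.
    apply/measurable_EFinP.
    apply: (measurableT_comp mp (g := pair (x, t))); exact: measurable_fun_pair.
  under eq_integral do rewrite gee0_abs ?lee_fin//.
  by rewrite p1 ltry.
rewrite (_ : \int[lamA]_a _ = \int[lamA]_a ((b ^+ 2)%:E * (p x t a)%:E
  + ((2 * b)%:E * (g x a * mu_star Gam x a)%:E
  + ((- (2 * b))%:E * (g x a * m t x a)%:E
  + draw (fun o => (wloss m o)%:E) t x a)))); last first.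
  apply: eq_integral => a _; rewrite draw_wloss /draw /aipw /=.
  under eq_integral => y _.
    rewrite (_ : (_ - tau0)%R = (b + g x a / p x t a * (y - m t x a))%R); last first.
      by rewrite /b /thetahat; ring.
    over.
  rewrite outcome_sq -!EFinM -!EFinD; congr (_%:E).
  (* Only the two unweighted occurrences of [g x a] are rewritten as density times weight, to match
     the left side. *)
  by rewrite -{3 4}(density_ratio x t a); ring.
have i1 := integrableZl measurableT (b ^+ 2)%R ip.
have i2 := integrableZl measurableT (2 * b)%R (int_star x).
have i3 := integrableZl measurableT (- (2 * b))%R (int_hat t x).
rewrite integralD//; last by do 2 apply: integrableD => //.
rewrite integralD//; last exact: integrableD.
rewrite integralD// !integralZl// p1 mule1 -/L; clearbody L.
rewrite !addeA leeD2r//.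
rewrite -(fineK (integrable_fin_num measurableT (int_star x))).
rewrite -(fineK (integrable_fin_num measurableT (int_hat t x))).
rewrite -!EFinM -!EFinD lee_fin -[fine _]/(theta x) -[fine _]/thetahat.
(* Here [s t + theta x - tau0] equals [b + (theta x - thetahat)], and the last square is dropped. *)
suff -> : ((s t + theta x - tau0) ^+ 2 = b ^+ 2 + 2 * b * theta x + - (2 * b) * thetahat
   + (theta x - thetahat) ^+ 2)%R by rewrite lerDl sqr_ge0.
by rewrite /b; ring.
Qed.

(** [s] stands for the error accumulated in earlier rounds. Integrating [action_sq] over the
    covariate, [covariate_sq] evaluates the first term. *)
Lemma step_aipw_sq (s : T -> R) t : measurable_fun setT s ->
  step (fun o => ((s o.1 + aipw m o - tau0) ^+ 2)%:E) t <=
  (s t ^+ 2)%:E + VarX Xi lamA Gam g + step (fun o => (wloss m o)%:E) t.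
Proof.
move=> ms.
have loss0 o : 0 <= (wloss m o)%:E.
  by rewrite lee_fin mulr_ge0 ?sqr_ge0// divr_ge0 ?sqr_ge0.
have mloss : measurable_fun setT (fun o => (wloss m o)%:E).
  by apply/measurable_EFinP; exact: measurable_wloss.
have msq : measurable_fun setT (fun x => ((s t + theta x - tau0) ^+ 2)%:E).
  apply/measurable_EFinP; apply: measurable_funX; apply: measurable_funB => //.
  exact: measurable_funD.
rewrite -covariate_sq /step -ge0_integralD//; last 3 first.
- by move=> x _; rewrite lee_fin sqr_ge0.
- by move=> x _; apply: integral_ge0 => a _; exact: draw_ge0.
- exact: measurable_draw_covariate.
have sq0 o : 0 <= ((s o.1 + aipw m o - tau0) ^+ 2)%:E by rewrite lee_fin sqr_ge0.
apply: ge0_le_integral => //.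
- by move=> x _; apply: integral_ge0 => a _; exact: draw_ge0.
- apply: measurable_draw_covariate => //.
  apply/measurable_EFinP; apply: measurable_funX; apply: measurable_funB => //.
  by apply: measurable_funD; [exact: measurableT_comp|exact: measurable_aipw].
- by apply: emeasurable_funD => //; exact: measurable_draw_covariate.
move=> x _; exact: action_sq.
Qed.

End online_estimate.

Lemma step_wloss (mu : X -> A -> R) t :
  measurable_fun setT (fun q : X * A => mu q.1 q.2) ->
  step (fun o => (wloss (fun=> mu) o)%:E) t =
  step (fun o => (wsq (sigma Gam) o)%:E) t +
  step (fun o => (wsq (fun x a => mu x a - mu_star Gam x a)%R o)%:E) t.
Proof.
move=> mmu; have wsq0 phi o : 0 <= (wsq phi o)%:E.
  by rewrite lee_fin; apply: divr_ge0; [apply: mulr_ge0|]; exact: sqr_ge0.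
have msigma : measurable_fun setT (fun o => (wsq (sigma Gam) o)%:E).
  by apply/measurable_EFinP; apply: measurable_wsq; exact: measurable_sigma.
have mdist : measurable_fun setT
    (fun o => (wsq (fun x a => mu x a - mu_star Gam x a)%R o)%:E).
  apply/measurable_EFinP; apply: measurable_wsq; apply: measurable_funB mmu _.
  exact: measurable_mu_star.
rewrite -(stepD _ (wsq0 _) (wsq0 _) msigma mdist).
rewrite /step; apply: eq_integral => x _; apply: eq_integral => a _.
by rewrite draw_wloss_split.
Qed.

End aipw_step.
End step.

(** * Expectation over histories, by iterating one round *)

Section history_expectation.
Context (d1 d2 : measure_display) (X : measurableType d1) (A : measurableType d2)
  (R : realType).
Unset Implicit Arguments.
Variables (Xi : probability X R) (lamA : {sigma_finite_measure set A -> \bar R})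
  (Gam : R.-pker (X * A) ~> R) (pi : forall i : nat, X -> H X A R i -> A -> R).
Hypothesis mpi : forall i, measurable_fun setT
  (fun q : X * H X A R i * A => pi i q.1.1 q.1.2 q.2).
Hypothesis pi0 : forall i x h a, (0 <= pi i x h a)%R.
Hypothesis pi1 : forall i x h, \int[lamA]_a (pi i x h a)%:E = 1.
Set Implicit Arguments.

Local Notation E := (Eplus Xi lamA Gam pi).

(** True by conversion, as [H X A R i.+1] computes to a product with the last triple; it transfers
    the facts on [step] to histories. *)
Lemma CondE i (F : H X A R i.+1 -> \bar R) :
  Cond Xi lamA Gam pi F = step Xi lamA Gam (pi i) F.
Proof. by []. Qed.

Lemma Cond_ge0 i (F : H X A R i.+1 -> \bar R) h :
  (forall o, 0 <= F o) -> 0 <= Cond Xi lamA Gam pi F h.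
Proof. by move=> F0; rewrite CondE; exact: (step_ge0 _ _ _ (pi0 i) h F0). Qed.

Lemma measurable_Cond i (F : H X A R i.+1 -> \bar R) :
    (forall o, 0 <= F o) -> measurable_fun [set: H X A R i.+1] F ->
  measurable_fun [set: H X A R i] (Cond Xi lamA Gam pi F).
Proof.
by move=> F0 mF; rewrite CondE; exact: (measurable_step _ _ _ (mpi i) (pi0 i) F0 mF).
Qed.

(** [Eplus] integrates out the last round first, so the induction on [k] keeps [F] general and is
    applied to [Cond F]. The next lemmas follow the same scheme. *)
Lemma Eplus_ge0 k (F : H X A R k -> \bar R) : (forall h, 0 <= F h) -> 0 <= E F.
Proof.
elim: k F => [F F0|k IH F F0] /=; first exact: F0.
by apply: IH => h; exact: Cond_ge0.
Qed.

Lemma le_Eplus k (F1 F2 : H X A R k -> \bar R) : (forall h, 0 <= F1 h) ->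
    measurable_fun [set: H X A R k] F1 -> measurable_fun [set: H X A R k] F2 ->
  (forall h, F1 h <= F2 h) -> E F1 <= E F2.
Proof.
elim: k F1 F2 => [F1 F2 _ _ _ F12|k IH F1 F2 F10 mF1 mF2 F12] /=; first exact: F12.
have F20 o : 0 <= F2 o by exact: le_trans (F12 o).
apply: IH.
- by move=> h; exact: Cond_ge0.
- exact: measurable_Cond.
- exact: measurable_Cond.
by move=> h; rewrite !CondE; exact: (le_step _ _ _ (mpi k) (pi0 k) h F10 mF1 mF2 F12).
Qed.

Lemma EplusD k (F1 F2 : H X A R k -> \bar R) :
    (forall h, 0 <= F1 h) -> (forall h, 0 <= F2 h) ->
    measurable_fun [set: H X A R k] F1 -> measurable_fun [set: H X A R k] F2 ->
  E (fun h => F1 h + F2 h) = E F1 + E F2.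
Proof.
elim: k F1 F2 => [//|k IH F1 F2 F10 F20 mF1 mF2] /=.
rewrite -IH; [|by move=> h; exact: Cond_ge0|by move=> h; exact: Cond_ge0
  |exact: measurable_Cond|exact: measurable_Cond].
congr (Eplus _ _ _ _ _); apply/funext => h; rewrite !CondE.
exact: (stepD _ _ _ (mpi k) (pi0 k) h F10 F20 mF1 mF2).
Qed.

Lemma EplusZ k (c : R) (F : H X A R k -> \bar R) :
    (0 <= c)%R -> (forall h, 0 <= F h) -> measurable_fun [set: H X A R k] F ->
  E (fun h => c%:E * F h) = c%:E * E F.
Proof.
move=> c0; elim: k F => [//|k IH F F0 mF] /=.
rewrite -IH; [|by move=> h; exact: Cond_ge0|exact: measurable_Cond].
congr (Eplus _ _ _ _ _); apply/funext => h; rewrite !CondE.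
exact: (stepZ _ _ _ (mpi k) (pi0 k) h c0 F0 mF).
Qed.

(** Consistency of the laws of successive histories: a new round does not change the law of the
    past. *)
Lemma Eplus_past k (G : H X A R k -> \bar R) : (forall h, 0 <= G h) ->
  E (fun h : H X A R k.+1 => G (hpast h)) = E G.
Proof.
move=> G0 /=; congr (Eplus _ _ _ _ _); apply/funext => h; rewrite CondE.
exact: (step_past _ _ (mpi k) (pi0 k) (pi1 k) h G0).
Qed.

Lemma Eplus_cst k (c : \bar R) : 0 <= c -> E (fun _ : H X A R k => c) = c.
Proof.
by move=> c0; elim: k => [//|k IH]; rewrite (Eplus_past (fun=> c0)).
Qed.

(** * Summation of the one-round bounds over the rounds *)

Section aipw_history.
Hypothesis Gam2 : forall x a, (Gam (x, a)).-integrable setT (fun y => (y ^+ 2)%:E).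
Variable g : X -> A -> R.
Hypothesis mg : measurable_fun setT (fun q : X * A => g q.1 q.2).
Unset Implicit Arguments.
Hypothesis pi_gt0 : forall i x h a, g x a != 0%R -> (0 < pi i x h a)%R.
Set Implicit Arguments.

Lemma measurable_hpast k : measurable_fun [set: H X A R k.+1] (@hpast _ _ X A R k).
Proof. exact: measurable_fst. Qed.

Lemma sumloss_ge0 m k (h : H X A R k) : (0 <= sumloss pi g m h)%R.
Proof.
elim: k h => [//|k IH h] /=; apply: addr_ge0 => //; rewrite /loss.
by rewrite mulr_ge0 ?sqr_ge0// divr_ge0 ?sqr_ge0.
Qed.

Section online_estimates.
Unset Implicit Arguments.
Variable m : forall i : nat, H X A R i -> X -> A -> R.
Hypothesis mm : forall i, measurable_fun setT
  (fun q : H X A R i * X * A => m i q.1.1 q.1.2 q.2).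
Set Implicit Arguments.

Lemma measurable_loss i :
  measurable_fun [set: H X A R i.+1] (fun h => loss pi g (m i (hpast h)) h).
Proof.
exact: (measurable_wloss (mpi i) (pi0 i) mg (mm i)).
Qed.

Lemma loss_ge0 i (h : H X A R i.+1) : 0 <= (loss pi g (m i (hpast h)) h)%:E.
Proof. by rewrite lee_fin /loss mulr_ge0 ?sqr_ge0// divr_ge0 ?sqr_ge0. Qed.

Lemma measurable_sumloss k : measurable_fun [set: H X A R k] (sumloss pi g m (k := k)).
Proof.
elim: k => [|k IH] /=; first exact: measurable_cst.
apply: measurable_funD; last exact: measurable_loss.
exact: measurableT_comp IH (@measurable_hpast k).
Qed.

Lemma measurable_aipw_sum k :
  measurable_fun [set: H X A R k] (aipw_sum lamA pi g m (k := k)).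
Proof.
elim: k => [|k IH] /=; first exact: measurable_cst.
apply: measurable_funD; first exact: measurableT_comp IH (@measurable_hpast k).
exact: (measurable_aipw lamA (mpi k) (pi0 k) mg (mm k)).
Qed.

Lemma Eplus_sumlossS k :
  E (fun h : H X A R k.+1 => (sumloss pi g m h)%:E) =
  E (fun h : H X A R k => (sumloss pi g m h)%:E) +
  E (fun h : H X A R k.+1 => (loss pi g (m k (hpast h)) h)%:E).
Proof.
have S0 j (h : H X A R j) : 0 <= (sumloss pi g m h)%:E by rewrite lee_fin sumloss_ge0.
rewrite -(Eplus_past (@S0 k)) -EplusD.
- by [].
- by move=> h; exact: S0.
- exact: loss_ge0.
- apply/measurable_EFinP.
  exact: measurableT_comp (@measurable_sumloss k) (@measurable_hpast k).
- by apply/measurable_EFinP; exact: measurable_loss.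
Qed.

Hypothesis int_star : forall x,
  lamA.-integrable setT (fun a => (g x a * mu_star Gam x a)%:E).
Unset Implicit Arguments.
Hypothesis int_hat : forall i h x,
  lamA.-integrable setT (fun a => (g x a * m i h x a)%:E).
Set Implicit Arguments.
Hypothesis int_tau : Xi.-integrable setT
  (fun x => ((innerA lamA (g x) (mu_star Gam x)) ^+ 2)%:E).

Let tau0 := tau Xi lamA Gam g.
(** Left unnormalized, so that each round adds exactly [aipw_term - tau0]. *)
Let err k (h : H X A R k) : R := (aipw_sum lamA pi g m h - k%:R * tau0)%R.

Let measurable_err k : measurable_fun [set: H X A R k] (@err k).
Proof. by apply: measurable_funB => //; exact: measurable_aipw_sum. Qed.

Lemma VarX_ge0 : 0 <= VarX Xi lamA Gam g.
Proof. by apply: integral_ge0 => x _; rewrite lee_fin sqr_ge0. Qed.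

Lemma Eplus_err_sqS k :
  E (fun h : H X A R k.+1 => (err h ^+ 2)%:E) <=
  E (fun h : H X A R k => (err h ^+ 2)%:E) + VarX Xi lamA Gam g +
  E (fun h : H X A R k.+1 => (loss pi g (m k (hpast h)) h)%:E).
Proof.
have mloss : measurable_fun [set: H X A R k.+1]
    (fun h => (loss pi g (m k (hpast h)) h)%:E).
  by apply/measurable_EFinP; exact: measurable_loss.
have mCl := measurable_Cond (@loss_ge0 k) mloss.
have Cl0 h := Cond_ge0 h (@loss_ge0 k).
have sq0 j (h : H X A R j) : 0 <= (err h ^+ 2)%:E by rewrite lee_fin sqr_ge0.
have msq j : measurable_fun [set: H X A R j] (fun h => (err h ^+ 2)%:E).
  by apply/measurable_EFinP; apply: measurable_funX; exact: measurable_err.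
(* With [VarX] as the expectation of a constant and the loss term unfolded by one round, the right
   side is a single expectation over the first [k] rounds, and integrands can be compared
   pointwise. *)
rewrite -[X in _ + X + _](@Eplus_cst k _ VarX_ge0).
rewrite -EplusD//; [|by move=> _; exact: VarX_ge0].
rewrite [X in _ + X]/= -EplusD//; last 2 first.
- by move=> h; apply: adde_ge0 => //; exact: VarX_ge0.
- by apply: emeasurable_funD.
apply: le_Eplus.
- by move=> h; exact: Cond_ge0.
- exact: measurable_Cond.
- by apply: emeasurable_funD => //; apply: emeasurable_funD.
move=> h; rewrite !CondE.
have errS (o : H X A R k.+1) :
    err o = (err (hpast o) + aipw_term lamA pi g m o - tau0)%R.
  by rewrite /err /= -natr1; ring.
under [X in step _ _ _ _ X]eq_fun do rewrite errS.
exact: (step_aipw_sq (mpi k) (pi0 k) (pi1 k) Gam2 mg (pi_gt0 k) (mm k)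
  int_star (int_hat k) int_tau h (@measurable_err k)).
Qed.

Lemma Eplus_err_sq k :
  E (fun h : H X A R k => (err h ^+ 2)%:E) <=
  (k%:R)%:E * VarX Xi lamA Gam g + E (fun h : H X A R k => (sumloss pi g m h)%:E).
Proof.
elim: k => [|k IH].
  by rewrite /= /err /= mul0r subr0 expr0n /= mul0e add0e.
apply: (le_trans (Eplus_err_sqS k)).
rewrite Eplus_sumlossS -natr1 EFinD ge0_muleDl ?lee_fin// mul1e.
rewrite [leRHS]addeA; apply: leeD2r.
by rewrite addeAC; exact: leeD2r.
Qed.

End online_estimates.

Lemma Eplus_sumloss_sum (mu : X -> A -> R) k :
    measurable_fun setT (fun q : X * A => mu q.1 q.2) ->
  E (fun h : H X A R k => (sumloss pi g (fun _ _ => mu) h)%:E) =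
  \sum_(i < k) (E (fun h : H X A R i.+1 => (wsq (pi i) g (sigma Gam) h)%:E) +
    E (fun h : H X A R i.+1 =>
         (wsq (pi i) g (fun x a => mu x a - mu_star Gam x a)%R h)%:E)).
Proof.
move=> mmu.
have wsq0 i phi (h : H X A R i.+1) : 0 <= (wsq (pi i) g phi h)%:E.
  by rewrite lee_fin; apply: divr_ge0; [apply: mulr_ge0|]; exact: sqr_ge0.
have mwsq i phi : measurable_fun setT (fun q : X * A => phi q.1 q.2) ->
    measurable_fun [set: H X A R i.+1] (fun h => (wsq (pi i) g phi h)%:E).
  by move=> mphi; apply/measurable_EFinP; exact: (measurable_wsq (mpi i) (pi0 i) mg).
have mmu' i : measurable_fun setT (fun q : H X A R i * X * A => mu q.1.2 q.2).
  apply: (measurableT_comp mmu (g := fun q : H X A R i * X * A => (q.1.2, q.2))).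
  by apply: measurable_fun_pair => //; exact: measurableT_comp.
elim: k => [|k IH]; first by rewrite big_ord0.
rewrite big_ord_recr (Eplus_sumlossS mmu') IH; congr (_ + _).
(* The last round is integrated out first, so that the split of [step_wloss] applies for each past
   history. *)
transitivity (E (fun h : H X A R k =>
    step Xi lamA Gam (pi k) (fun o => (wsq (pi k) g (sigma Gam) o)%:E) h +
    step Xi lamA Gam (pi k) (fun o =>
      (wsq (pi k) g (fun x a => mu x a - mu_star Gam x a)%R o)%:E) h)).
  rewrite -[LHS]/(E (fun h : H X A R k => step Xi lamA Gam (pi k)
    (fun o => (wloss (pi k) g (fun=> mu) o)%:E) h)).
  congr (Eplus _ _ _ _ _); apply/funext => h.
  exact: (step_wloss Xi lamA (mpi k) (pi0 k) Gam2 mg h mmu).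
apply: EplusD.
- by move=> h; exact: Cond_ge0.
- by move=> h; exact: Cond_ge0.
- apply: (measurable_Cond (@wsq0 k _)); apply: mwsq; exact: measurable_sigma.
- apply: (measurable_Cond (@wsq0 k _)); apply: mwsq; apply: measurable_funB mmu _.
  exact: measurable_mu_star.
Qed.

Lemma sum_Eplus_wsq (phi : X -> A -> R) k : (0 < k)%N ->
  \sum_(i < k) E (fun h : H X A R i.+1 => (wsq (pi i) g phi h)%:E) =
  (k%:R)%:E * normsq Xi lamA Gam pi g k phi.
Proof.
by move=> k_gt0; rewrite /normsq muleA -EFinM mulfV ?mul1e// pnatr_eq0 -lt0n.
Qed.

Lemma normsq_ge0 (phi : X -> A -> R) k : 0 <= normsq Xi lamA Gam pi g k phi.
Proof.
rewrite mule_ge0 ?lee_fin// sume_ge0// => i _.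
apply: Eplus_ge0 => h; rewrite lee_fin.
by apply: divr_ge0; [apply: mulr_ge0|]; exact: sqr_ge0.
Qed.

Lemma Eplus_sumloss_fixed (mu : X -> A -> R) k :
    measurable_fun setT (fun q : X * A => mu q.1 q.2) -> (0 < k)%N ->
  E (fun h : H X A R k => (sumloss pi g (fun _ _ => mu) h)%:E) =
  (k%:R)%:E * (normsq Xi lamA Gam pi g k (sigma Gam)
    + normsq Xi lamA Gam pi g k (fun x a => mu x a - mu_star Gam x a)%R).
Proof.
move=> mmu k_gt0; rewrite (Eplus_sumloss_sum k mmu) big_split.
rewrite (ge0_muleDr _ (normsq_ge0 _ _) (normsq_ge0 _ _)).
by congr (_ + _); exact: sum_Eplus_wsq.
Qed.

End aipw_history.
End history_expectation.

(** * Extended-real arithmetic and the passage to the regret *)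

(** Used with [q] the second moment of the unnormalized error, [v] and [s] the two parts of the
    efficient variance, [l] the expected cumulative loss, [ep] and [em] the expected positive and
    negative parts of the regret, and [D] the set of squared distances to [mu_star]. *)
Lemma average_bound (R : realType) (n : nat) (q v s l ep em : \bar R)
    (D : set (\bar R)) : (0 < n)%N ->
    0 <= q -> 0 <= l -> v \is a fin_num -> s \is a fin_num ->
    ep \is a fin_num -> em \is a fin_num -> D !=set0 ->
    (forall d, D d -> 0 <= d < +oo) -> q <= (n%:R)%:E * v + l ->
    (forall d, D d -> l + em <= (n%:R)%:E * (s + d) + ep) ->
  ((n%:R^-1) ^+ 2)%:E * q <=
  (n%:R^-1)%:E * (v + s + (n%:R^-1)%:E * (ep - em) + ereal_inf D).
Proof.
move=> n0 q0 l0 /fineK<- /fineK<- /fineK<- /fineK<- [d0 Dd0] Dfin.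
move: (fine v) (fine s) (fine ep) (fine em) => {}v {}s {}ep {}em qle lle.
have [r Er] : exists r : R, d0 = r%:E.
  have /andP[d00 d0oo] := Dfin _ Dd0.
  by exists (fine d0); rewrite fineK// ge0_fin_numE.
have n0R : (0 < n%:R :> R)%R by rewrite ltr0n.
(* A single element of [D] already bounds [l] by a finite quantity. *)
have lfin : l \is a fin_num.
  have := lle _ Dd0; rewrite Er ge0_fin_numE// => h.
  by case: (l) h => [x _|//|_]; rewrite ?ltry.
move: lfin l0 qle lle => /fineK<-; move: (fine l) => {}l l0 qle lle.
have qfin : q \is a fin_num.
  by rewrite ge0_fin_numE// (le_lt_trans qle)// ltry.
move: qfin q0 qle => /fineK<-; move: (fine q) => {}q q0.
rewrite lee_fin => qle.
(* Solving each inequality for [d] gives a lower bound common to all of [D], hence one for the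
   infimum, which may not be attained. *)
have infge : (n%:R^-1 * (l + em - ep) - s)%:E <= ereal_inf D.
  apply: le_ereal_inf_tmp => d Dd; have := lle _ Dd; have /andP[d_ge0 doo] := Dfin _ Dd.
  have /fineK<- : d \is a fin_num by rewrite ge0_fin_numE.
  rewrite !lee_fin => h.
  by rewrite lerBlDl mulrC ler_pdivrMr// mulrC; lra.
have /fineK Ej : ereal_inf D \is a fin_num.
  apply: fin_real; rewrite (lt_le_trans _ infge) ?ltNyr//=.
  by rewrite (le_lt_trans (ereal_inf_lbound Dd0))// Er ltry.
move: infge; rewrite -Ej; move: (fine (ereal_inf D)) => j; rewrite lee_fin => infge.
rewrite lee_fin expr2 -mulrA ler_pM2l ?invr_gt0//.
have : (n%:R^-1 * q <= n%:R^-1 * (n%:R * v + l))%R by rewrite ler_pM2l ?invr_gt0.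
rewrite !(mulrDr, mulrN) mulKf ?gt_eqF// in infge *.
lra.
Qed.

(* [L + Reg^- <= L_mu + Reg^+] restates [L - L_mu <= Reg] without subtraction, so
   that it can be integrated with [Eplus]. *)
Lemma Regret_split (d1 d2 : measure_display) (X : measurableType d1)
    (A : measurableType d2) (R : realType)
    (pi : forall i : nat, X -> H X A R i -> A -> R) (g : X -> A -> R)
    (muhat : forall i : nat, H X A R i -> X -> A -> R) (F : set (X -> A -> R))
    (n : nat) (mu : X -> A -> R) (h : H X A R n) : F mu ->
  (sumloss pi g muhat h)%:E + (Regret pi g muhat F (n := n))^\- h <=
  (sumloss pi g (fun _ _ => mu) h)%:E + (Regret pi g muhat F (n := n))^\+ h.
Proof.
move=> Fmu; rewrite funeposE funenegE /Regret.
set L := sumloss pi g muhat h; set Lmu := sumloss pi g (fun=> fun=> mu) h.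
set I := ereal_inf _.
have I_le : I <= Lmu%:E by apply: ereal_inf_lbound; exists mu.
have I_ge0 : 0 <= I.
  apply: le_ereal_inf_tmp => _ [nu _ <-]; rewrite lee_fin; exact: sumloss_ge0.
have /fineK EI : I \is a fin_num by rewrite ge0_fin_numE// (le_lt_trans I_le) ?ltry.
move: I_le; rewrite -EI; clearbody L Lmu; move: (fine I) => r; rewrite lee_fin => rle.
rewrite -EFinB -EFinN -!EFin_max -!EFinD lee_fin.
by rewrite /Num.max; case: ltP => ?; case: ltP => ?; lra.
Qed.

(** * The mean squared error bound *)

Theorem theorem2
  (d1 d2 : measure_display) (X : measurableType d1) (A : measurableType d2)
  (R : realType)
  (Xi : probability X R)
  (lamA : {sigma_finite_measure set A -> \bar R})
  (Gam : R.-pker (X * A) ~> R)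
  (pi : forall i : nat, X -> H X A R i -> A -> R)
  (g : X -> A -> R)
  (muhat : forall i : nat, H X A R i -> X -> A -> R)
  (F : set (X -> A -> R))
  (n : nat)
  (* n >= 1 *)
  (hn : (0 < n)%N)
  (* conditional variance finite *)
  (hGam2 : forall x a, (Gam (x, a)).-integrable setT (fun y => (y ^+ 2)%:E))
  (* behavioral policies: measurable probability densities w.r.t. lamA *)
  (hpi_meas : forall i, measurable_fun setT
      (fun p : X * H X A R i * A => pi i p.1.1 p.1.2 p.2))
  (hpi_ge0 : forall i x h a, (0 <= pi i x h a)%R)
  (hpi_int1 : forall i x h, \int[lamA]_a (pi i x h a)%:E = 1)
  (* overlap: the density is positive wherever g does not vanish *)
  (hpi_pos : forall i x h a, g x a != 0%R -> (0 < pi i x h a)%R)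
  (hg_meas : measurable_fun setT (fun p : X * A => g p.1 p.2))
  (* the online estimates depend measurably on the past only *)
  (hmu_meas : forall i, measurable_fun setT
      (fun p : H X A R i * X * A => muhat i p.1.1 p.1.2 p.2))
  (hF_meas : forall mu, F mu -> measurable_fun setT (fun p : X * A => mu p.1 p.2))
  (hF_ne : F !=set0)
  (* finiteness of the inner products and expectations appearing *)
  (hint_star : forall x, lamA.-integrable setT
      (fun a => (g x a * mu_star Gam x a)%:E))
  (hint_hat : forall i h x, lamA.-integrable setT
      (fun a => (g x a * muhat i h x a)%:E))
  (hint_tau : Xi.-integrable setT
      (fun x => ((innerA lamA (g x) (mu_star Gam x)) ^+ 2)%:E))
  (hreg_meas : measurable_fun [set: H X A R n] (fun h : H X A R n => Regret pi g muhat F h))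
  (hreg_fin : Eplus Xi lamA Gam pi (fun h : H X A R n => `|Regret pi g muhat F h|) < +oo)
  (hmse_fin : Eplus Xi lamA Gam pi
      (fun h : H X A R n =>
         ((tau_hat lamA pi g muhat h - tau Xi lamA Gam g) ^+ 2)%:E) < +oo)
  (hsig_fin : normsq Xi lamA Gam pi g n (sigma Gam) < +oo)
  (hdist_fin : forall mu, F mu ->
      normsq Xi lamA Gam pi g n (fun x a => mu x a - mu_star Gam x a)%R < +oo) :
  Eplus Xi lamA Gam pi
      (fun h : H X A R n =>
         ((tau_hat lamA pi g muhat h - tau Xi lamA Gam g) ^+ 2)%:E)
  <= (n%:R^-1)%:E *
     (vstar2 Xi lamA Gam pi g n
      + (n%:R^-1)%:E * Exp Xi lamA Gam pi (fun h : H X A R n => Regret pi g muhat F h)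
      + ereal_inf [set normsq Xi lamA Gam pi g n (fun x a => mu x a - mu_star Gam x a)%R
                   | mu in F]).
Proof.
have mE := Eplus_err_sq hpi_meas hpi_ge0 hpi_int1 hGam2 hg_meas hpi_pos hmu_meas
  hint_star hint_hat hint_tau n.
set Reg := fun h : H X A R n => Regret pi g muhat F h.
set L := fun h : H X A R n => (sumloss pi g muhat h)%:E in mE.
have L0 h : 0 <= L h by rewrite lee_fin sumloss_ge0.
have mL : measurable_fun [set: H X A R n] L.
  by apply/measurable_EFinP; exact: (measurable_sumloss hpi_meas hpi_ge0 hg_meas hmu_meas).
pose S (h : H X A R n) : R := (aipw_sum lamA pi g muhat h - n%:R * tau Xi lamA Gam g)%R.
have mS : measurable_fun [set: H X A R n] S.
  apply: measurable_funB; last exact: measurable_cst.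
  exact: (measurable_aipw_sum lamA hpi_meas hpi_ge0 hg_meas hmu_meas).
have S0 h : 0 <= (S h ^+ 2)%:E by rewrite lee_fin sqr_ge0.
(* [tau_hat - tau] is [S / n], which produces the factor [n^-2]. *)
have -> : (fun h : H X A R n => ((tau_hat lamA pi g muhat h - tau Xi lamA Gam g) ^+ 2)%:E)
    = (fun h => ((n%:R^-1) ^+ 2)%:E * (S h ^+ 2)%:E).
  apply/funext => h; rewrite -EFinM -exprMn; congr ((_ ^+ 2)%:E).
  by rewrite /S mulrBr mulKf// pnatr_eq0 -lt0n.
have mS2 : measurable_fun [set: H X A R n] (fun h => (S h ^+ 2)%:E).
  by apply/measurable_EFinP; exact: measurable_funX.
rewrite (EplusZ Xi lamA Gam hpi_meas hpi_ge0 (sqr_ge0 _) S0 mS2).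
have mpos := measurable_funepos hreg_meas.
have mneg := measurable_funeneg hreg_meas.
have mabs : measurable_fun [set: H X A R n] (fun h => `|Reg h|).
  exact: measurableT_comp hreg_meas.
(* Both parts of the regret are dominated by its absolute value, so [Exp] is a difference of finite
   numbers. *)
have fin_part (G : H X A R n -> \bar R) : (forall h, 0 <= G h) ->
    measurable_fun [set: H X A R n] G -> (forall h, G h <= `|Reg h|) ->
    Eplus Xi lamA Gam pi G \is a fin_num.
  move=> G0 mG Gle; rewrite ge0_fin_numE; last exact: (Eplus_ge0 Xi lamA Gam hpi_ge0 G0).
  apply: le_lt_trans hreg_fin.
  exact: (le_Eplus Xi lamA Gam hpi_meas hpi_ge0 G0 mG mabs Gle).
apply: (average_bound hn).
- exact: (Eplus_ge0 Xi lamA Gam hpi_ge0 S0).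
- exact: (Eplus_ge0 Xi lamA Gam hpi_ge0 L0).
- by rewrite (VarXE hg_meas hint_tau).
- by rewrite ge0_fin_numE//; exact: normsq_ge0.
- apply: fin_part; [exact: funepos_ge0|exact: mpos|].
  by move=> h; rewrite -/(Reg h) funeposE ge_max abse_ge0 lee_abs.
- apply: fin_part; [exact: funeneg_ge0|exact: mneg|].
  by move=> h; rewrite -/(Reg h) funenegE ge_max abse_ge0 -abseN lee_abs.
- by have [mu Fmu] := hF_ne; eexists; exists mu; first exact: Fmu.
- by move=> _ [mu Fmu <-]; apply/andP; split; [exact: normsq_ge0|exact: hdist_fin].
- exact: mE.
move=> _ [mu Fmu <-].
(* The right side becomes the expected loss of [mu] plus the expected positive part of the regret,
   so the claim follows by integrating [Regret_split]. *)
rewrite -(Eplus_sumloss_fixed Xi hpi_meas hpi_ge0 hpi_int1 hGam2 hg_meas (hF_meas _ Fmu) hn).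
have Lmu0 (h : H X A R n) : 0 <= (sumloss pi g (fun _ _ => mu) h)%:E.
  by rewrite lee_fin sumloss_ge0.
have mLmu : measurable_fun [set: H X A R n] (fun h => (sumloss pi g (fun _ _ => mu) h)%:E).
  apply/measurable_EFinP; apply: (measurable_sumloss hpi_meas hpi_ge0 hg_meas) => i.
  apply: (measurableT_comp (hF_meas _ Fmu) (g := fun q : H X A R i * X * A => (q.1.2, q.2))).
  by apply: measurable_fun_pair => //; exact: measurableT_comp.
rewrite -(EplusD Xi lamA Gam hpi_meas hpi_ge0 L0 (funeneg_ge0 _) mL mneg).
rewrite -(EplusD Xi lamA Gam hpi_meas hpi_ge0 Lmu0 (funepos_ge0 _) mLmu mpos).
apply: (le_Eplus Xi lamA Gam hpi_meas hpi_ge0).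
- by move=> h; apply: adde_ge0; [exact: L0|exact: funeneg_ge0].
- exact: emeasurable_funD mL mneg.
- exact: emeasurable_funD mLmu mpos.
by move=> h; exact: Regret_split.
Qed.
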